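(* Let $q$ be any prime power and let $\mathcal C$ be a system of representatives of the cosets of the subgroup $(\mathbb F_q^* )^{(3)}=\{x^3:x\in\mathbb F_q^*\}$ in $\mathbb F_q^*$. Then every rational function of degree $3$ in $\mathbb F_q(X)$ belonging to Class II is equivalent to exactly one of the functions \[ \frac{X^3+t}{X},\ t\in\mathcal C,\qquad \frac{X^3+X^2+t}{X},\ t\in\mathbb F_q^*, \] (so these are representatives of the equivalence classes in Class II), and the number of equivalence classes in Class II is $q+2$ if $q\equiv 1\pmod 3$ and $q$ if $q\not\equiv 1\pmod 3$.
   Context: $\mathbb F_q$ is the field with $q$ elements. For a nonconstant $f=g/h\in\mathbb F_q(X)$ with $g,h\in\mathbb F_q[X]$ coprime, $\deg f=\max\{\deg g,\deg h\}$. $\mathrm{PGL}(2,\mathbb F_q)$ is the group (under composition) of degree-one rational functions $(aX+b)/(cX+d)$, $a,b,c,d\in\mathbb F_q$, $ad-bc\neq0$. Two nonconstant $f,g\in\mathbb F_q(X)$ are equivalent if $g=\psi\circ f\circ\phi$ for some $\psi,\phi\in\mathrm{PGL}(2,\mathbb F_q)$. A rational function induces a map $\mathbb P^1(\mathbb F_q)=\mathbb F_q\cup\{\infty\}\to\mathbb P^1(\mathbb F_q)$, and $f^{-1}(\alpha)$ denotes the preimage in $\mathbb P^1(\mathbb F_q)$. A degree-$3$ function $f$ is in Class II if $|f^{-1}(\alpha)|=2$ for some $\alpha\in\mathbb P^1(\mathbb F_q)$. *)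

(* Defs.v *)
From HB Require Import structures.
From mathcomp Require Import all_boot all_order all_fingroup all_algebra.
From mathcomp Require Import generic_quotient.
From mathcomp Require Import classical_sets functions cardinality.

Set Implicit Arguments.
Unset Strict Implicit.
Unset Printing Implicit Defensive.

Import GRing.Theory.
Local Open Scope ring_scope.
Local Open Scope quotient_scope.

Section RationalFunctions.
Variable F : finFieldType.

Definition ratfun := {fraction {poly F}}.

(* An arbitrary representative n / d of f, reduced by the gcd so that
   f = rnum f / rden f with rnum f and rden f coprime. Both are determined
   by f only up to a common nonzero constant factor, on which none of the
   definitions below depends. *)
Definition rnum (f : ratfun) : {poly F} :=
  let r := frac (repr f) in r.1 %/ gcdp r.1 r.2.
Definition rden (f : ratfun) : {poly F} :=
  let r := frac (repr f) in r.2 %/ gcdp r.1 r.2.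

Definition rdeg (f : ratfun) : nat :=
  maxn (size (rnum f)).-1 (size (rden f)).-1.

Definition rpoly (p : {poly F}) : ratfun := tofrac p.

Definition rconst (a : F) : ratfun := rpoly a%:P.

(* Meaningful for nonconstant g, where the denominator is nonzero. *)
Definition rcomp (f g : ratfun) : ratfun :=
  (map_poly rconst (rnum f)).[g] / (map_poly rconst (rden f)).[g].

Definition in_PGL2 (phi : ratfun) : Prop :=
  exists a b c d : F, a * d - b * c != 0 /\
    phi = rpoly (a *: 'X + b%:P) / rpoly (c *: 'X + d%:P).

Definition requiv (f g : ratfun) : Prop :=
  [/\ (0 < rdeg f)%N, (0 < rdeg g)%N &
    exists psi phi : ratfun,
      [/\ in_PGL2 psi, in_PGL2 phi & g = rcomp psi (rcomp f phi)]].

(* The projective line over F is option F, with None the point at infinity.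
   At infinity, when size (rnum f) <= size (rden f), the value is the ratio of
   the coefficients in degree deg (rden f); it is 0 when the first
   inequality is strict. *)
Definition reval (f : ratfun) (x : option F) : option F :=
  match x with
  | Some a =>
      if root (rden f) a then None else Some ((rnum f).[a] / (rden f).[a])
  | None =>
      if (size (rden f) < size (rnum f))%N then None
      else Some ((rnum f)`_(size (rden f)).-1 / lead_coef (rden f))
  end.

Definition rfiber (f : ratfun) (alpha : option F) : {set option F} :=
  [set x | reval f x == alpha]%SET.

Definition class_II (f : ratfun) : Prop :=
  rdeg f = 3%N /\ exists alpha : option F, #|rfiber f alpha| = 2%N.

Definition classes_II : set (set ratfun) :=
  [set [set g | requiv f g] | f in [set f | class_II f]]%classic.

Definition unit_cubes : {set {unit F}} :=
  [set (x ^+ 3)%g | x in [set: {unit F}]]%SET.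

Definition cube_coset_reps (C : {set {unit F}}) : Prop :=
  is_transversal C (rcosets unit_cubes [set: {unit F}]) [set: {unit F}].

Definition canonical_II (C : {set {unit F}}) (g : ratfun) : Prop :=
  (exists2 t : {unit F}, t \in C &
     g = rpoly ('X^3 + (FinRing.uval t)%:P) / rpoly 'X) \/
  (exists t : {unit F},
     g = rpoly ('X^3 + 'X^2 + (FinRing.uval t)%:P) / rpoly 'X).

End RationalFunctions.

Arguments classes_II F : clear implicits.
Arguments unit_cubes F : clear implicits.

(* Main.v *)
Require Import Defs.
From HB Require Import structures.
From mathcomp Require Import all_boot all_order all_fingroup all_algebra.
From mathcomp Require Import all_solvable all_field generic_quotient.
From mathcomp Require Import classical_sets functions cardinality ring.

(* If the fiber of a cubic f over alpha has exactly two rational points, then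
   it is the divisor 2[P] + [Q]. Moving alpha and P to infinity and Q to 0
   turns f into (X^3 + beta X^2 + t) / X, with t != 0. Such a function may have
   other fibers of this shape, so uniqueness is not immediate: an equivalence
   between the functions with parameters (beta, t) and (beta', t') can move the
   double point. Comparing coefficients shows nevertheless that
   (beta', t') = (beta r, t r^3) for some r != 0, so beta can be normalized to
   0 or 1, and t is then determined up to cubes, respectively uniquely. *)

Set Implicit Arguments.
Unset Strict Implicit.
Unset Printing Implicit Defensive.

Import GRing.Theory.
Local Open Scope ring_scope.

(** A fiber is the zero set of a cubic form over [F]. When two rational zeros are known, the
    remaining linear factor is also defined over [F], so its zero is rational and must repeat one of
    the two: counting rational points alone fixes the multiplicities. Forms of degree 3 are used
    instead of polynomials so that infinity is an ordinary point. For uniqueness, the numerator and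
    denominator of [(X^3 + beta X^2 + t) / X] span a pencil of cubics [c3 X^3 + c2 X^2 + c1 X + c0],
    cut out by [c2 = beta c3] and [c0 = t c3]. Post-composition only changes the basis of the
    pencil, so an equivalence reduces to four equations in the coefficients [a, b, c, d] of the
    inner substitution. They are solved by multiplying through by [a], [c] and [a d - b c] only,
    never dividing by 2 or 3, so that all characteristics are treated at once. The number of classes
    is [q - 1], from [beta = 1], plus the index [gcd(q - 1, 3)] of the cubes, from [beta = 0]. *)

Lemma tofrac_repr (R : idomainType) (x : {fraction R}) :
  x = FracField.tofrac (frac (repr x)).1 / FracField.tofrac (frac (repr x)).2.
Proof.
have d0 : FracField.tofrac (frac (repr x)).2 != 0.
  by rewrite tofrac_eq0 denom_ratioP.
apply: (canRL (mulfK d0)).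
rewrite -{1}[x]reprK; unlock FracField.tofrac; rewrite -[LHS]FracField.pi_mul.
apply/eqmodP => /=; rewrite FracField.equivfE /FracField.mulf.
rewrite !numden_Ratio ?oner_eq0 ?mulf_neq0 ?denom_ratioP ?oner_eq0 //.
by rewrite !mulr1 mulrC.
Qed.

Lemma expr_div_mul (K : fieldType) (x y : K) (i k : nat) :
  y != 0 -> (i <= k)%N -> (x / y) ^+ i * y ^+ k = x ^+ i * y ^+ (k - i).
Proof.
move=> y0 le; rewrite expr_div_n -{1}(subnKC le) exprD mulrA.
by rewrite divfK // expf_neq0.
Qed.

Lemma subf_div (K : fieldType) (x y z t : K) :
  y != 0 -> t != 0 -> x / y - z / t = (x * t - z * y) / (y * t).
Proof. by move=> y0 t0; field; rewrite y0 t0. Qed.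

(** * Reduced fractions, evaluation and composition of rational functions *)

Section RationalFunctions.
Variable F : finFieldType.
Implicit Types (f g h : ratfun F) (p q n d : {poly F}).

Local Notation ratX := (rpoly 'X : ratfun F).

HB.instance Definition _ :=
  GRing.RMorphism.copy (@rpoly F) (@FracField.tofrac {poly F}).
HB.instance Definition _ :=
  GRing.RMorphism.copy (@rconst F) (@FracField.tofrac {poly F} \o polyC).

Lemma rpoly_eq p q : (rpoly p == rpoly q) = (p == q).
Proof. exact: tofrac_eq. Qed.

Lemma rpoly_eq0 p : (rpoly p == 0) = (p == 0).
Proof. exact: tofrac_eq0. Qed.

Lemma rden_neq0 f : rden f != 0.
Proof.
have d0 := denom_ratioP (repr f).
by rewrite /rden dvdp_div_eq0 ?dvdp_gcdr.
Qed.

Lemma coprime_rnum_rden f : coprimep (rnum f) (rden f).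
Proof. by rewrite coprimep_div_gcd // denom_ratioP orbT. Qed.

Lemma rnum_rden f : f = rpoly (rnum f) / rpoly (rden f).
Proof.
rewrite {1}[f]tofrac_repr.
have d0 := denom_ratioP (repr f).
set n := _.1; set d := _.2.
have g0 : gcdp n d != 0 by rewrite gcdp_eq0 negb_and d0 orbT.
have -> : FracField.tofrac n = rpoly (rnum f) * rpoly (gcdp n d).
  by rewrite -rmorphM /rnum /= divpK // dvdp_gcdl.
have -> : FracField.tofrac d = rpoly (rden f) * rpoly (gcdp n d).
  by rewrite -rmorphM /rden /= divpK // dvdp_gcdr.
by rewrite -mulf_div divff ?mulr1 // rpoly_eq0.
Qed.

Lemma ratfunP f : exists p q, q != 0 /\ f = rpoly p / rpoly q.
Proof. exists (rnum f), (rden f); split; [exact: rden_neq0|exact: rnum_rden]. Qed.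

(** By Gauss, the denominators of two coprime fractions for [f] divide each other. This controls the
    arbitrary choice in [rnum] and [rden], so that degree and fibers can be read off an explicit
    fraction. *)
Lemma rnum_rden_coprime f p q : q != 0 -> coprimep p q ->
  f = rpoly p / rpoly q ->
  exists2 k : F, k != 0 & rnum f = k *: p /\ rden f = k *: q.
Proof.
move=> q0 cpq fE.
have e : p * rden f = rnum f * q.
  apply/eqP; rewrite -rpoly_eq !rmorphM /= -eqr_div ?rpoly_eq0 ?rden_neq0 //.
  by rewrite -fE -rnum_rden.
have d1 : q %| rden f.
  by rewrite -(Gauss_dvdpr _ (_ : coprimep q p)) ?e ?dvdp_mull // coprimep_sym.
have d2 : rden f %| q.
  have := coprime_rnum_rden f; rewrite coprimep_sym => cp.
  by rewrite -(Gauss_dvdpr _ cp) -e dvdp_mull.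
have /eqpf_eq[k k0 qE] : rden f %= q by rewrite /eqp d1 d2.
exists k => //; split=> //; apply: (mulIf q0).
by rewrite -e qE -scalerAr scalerAl.
Qed.

Definition evalr (g : ratfun F) p : ratfun F := (map_poly (@rconst F) p).[g].

Lemma evalr_zmod_morphism g : zmod_morphism (evalr g).
Proof. by move=> p q; rewrite /evalr rmorphB hornerD hornerN. Qed.
Lemma evalr_monoid_morphism g : monoid_morphism (evalr g).
Proof. by split=> [|p q]; rewrite /evalr ?rmorph1 ?hornerC // rmorphM hornerM. Qed.
HB.instance Definition _ g :=
  GRing.isZmodMorphism.Build _ _ (evalr g) (evalr_zmod_morphism g).
HB.instance Definition _ g :=
  GRing.isMonoidMorphism.Build _ _ (evalr g) (evalr_monoid_morphism g).

Lemma evalrX g : evalr g 'X = g.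
Proof. by rewrite /evalr map_polyX hornerX. Qed.

Lemma evalrC g (a : F) : evalr g a%:P = rconst a.
Proof. by rewrite /evalr map_polyC hornerC. Qed.

Lemma evalrZ g (a : F) p : evalr g (a *: p) = rconst a * evalr g p.
Proof. by rewrite -mul_polyC rmorphM /= evalrC. Qed.

Lemma evalr_rpoly q p : evalr (rpoly q) p = rpoly (p \Po q).
Proof.
elim/poly_ind: p => [|p a IH]; first by rewrite comp_poly0 !rmorph0.
by rewrite rmorphD rmorphM /= evalrX evalrC IH comp_polyD comp_polyM comp_polyX
  comp_polyC rmorphD rmorphM.
Qed.

(** Under this condition [rcomp f g] can be computed from any fraction for [f], reduced or not, and
    is a ring morphism in [f]. *)
Definition transcendental g := forall p, p != 0 -> evalr g p != 0.

(** Clearing denominators in [p(g) = 0] shows that the denominator of [g] divides a power of its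
    numerator, hence is constant by coprimality. Then [g] is a nonconstant polynomial, and a nonzero
    [p] composed with it is nonzero. *)
Lemma rdeg_transcendental g : (0 < rdeg g)%N -> transcendental g.
Proof.
move=> dg p p0; apply/eqP => pg0.
set n := rnum g; set d := rden g; have d0 : d != 0 := rden_neq0 g.
have gE : g = rpoly n / rpoly d := rnum_rden g.
have rd0 : rpoly d != 0 by rewrite rpoly_eq0.
have e0 : lead_coef p *: n ^+ (size p).-1 +
    \sum_(i < (size p).-1) p`_i *: (n ^+ i * d ^+ ((size p).-1 - i)) = 0.
  apply/eqP; rewrite -rpoly_eq0; apply/eqP.
  transitivity (evalr g p * rpoly d ^+ (size p).-1); last by rewrite pg0 mul0r.
  have -> : evalr g p = \sum_(i < (size p).-1.+1) rconst p`_i * g ^+ i.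
    rewrite /evalr horner_coef size_map_poly prednK ?size_poly_gt0 //.
    by apply: eq_bigr => i _; rewrite coef_map.
  have term i : (i <= (size p).-1)%N ->
      rconst p`_i * g ^+ i * rpoly d ^+ (size p).-1 =
      rpoly (p`_i *: (n ^+ i * d ^+ ((size p).-1 - i))).
    move=> le; rewrite -mul_polyC !rmorphM !rmorphXn /= gE -mulrA.
    by rewrite expr_div_mul.
  rewrite big_ord_recr /= mulrDl term // subnn expr0 mulr1 addrC.
  rewrite rmorphD rmorph_sum /= mulr_suml; congr (_ + _).
  by apply: eq_bigr => i _; rewrite term // ltnW.
have dn : d %| n ^+ (size p).-1.
  rewrite -(@dvdpZr _ (lead_coef p)) ?lead_coef_eq0 //.
  move/eqP: e0; rewrite addr_eq0 => /eqP ->; rewrite dvdpNr.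
  apply: (big_ind (fun x => d %| x)) => [|x y dx dy|i _].
  - exact: dvdp0.
  - exact: dvdp_add.
  rewrite -mul_polyC dvdp_mull // dvdp_mull // dvdp_exp // subn_gt0.
  exact: ltn_ord.
have [a a0 dE] : exists2 a, a != 0 & d = a%:P.
  apply/size_poly1P; rewrite -dvdp1.
  rewrite -(Gauss_dvdpr _ (_ : coprimep d (n ^+ (size p).-1))).
    by rewrite mulr1.
  by rewrite coprimep_expr // coprimep_sym coprime_rnum_rden.
have gE' : g = rpoly (a^-1 *: n).
  rewrite gE dE -mul_polyC rmorphM /= mulrC; congr (_ * _).
  by rewrite -[RHS]/(rconst _) -[in LHS]/(rconst a) fmorphV.
move: dg; rewrite /rdeg -/n -/d dE size_polyC a0 maxn0 => dg.
move/eqP: pg0; rewrite gE' evalr_rpoly rpoly_eq0 comp_poly_eq0 ?(negbTE p0) //.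
by rewrite size_scale ?invr_eq0 //; case: (size n) dg => [|[]].
Qed.

Lemma nonconst_rdeg g : (forall a : F, g != rconst a) -> (0 < rdeg g)%N.
Proof.
move=> gnc; rewrite lt0n; apply/eqP => /eqP.
rewrite /rdeg -leqn0 geq_max !leqn0 => /andP[n1 d1].
have small p : ((size p).-1 == 0)%N -> p = (p`_0)%:P.
  by move=> sp; apply: size1_polyC; case: (size p) sp => [|[]].
have /eqP[] := gnc ((rnum g)`_0 / (rden g)`_0).
by rewrite {1}[g]rnum_rden (small _ n1) (small _ d1) !coefC eqxx fmorph_div.
Qed.

Lemma transcendental_neq g (a : F) : transcendental g -> g != rconst a.
Proof.
move=> tg; have := tg ('X - a%:P); rewrite polyXsubC_eq0 => /(_ isT).
by rewrite rmorphB /= evalrX evalrC subr_eq0.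
Qed.

Lemma transcendental_rdeg g : transcendental g -> (0 < rdeg g)%N.
Proof. by move=> tg; apply: nonconst_rdeg => a; exact: transcendental_neq. Qed.

Lemma rcompE f g p q : transcendental g -> q != 0 -> f = rpoly p / rpoly q ->
  rcomp f g = evalr g p / evalr g q.
Proof.
move=> tg q0 fE; rewrite /rcomp -!/(evalr _ _).
apply/eqP; rewrite eqr_div ?tg ?rden_neq0 // -!rmorphM /=.
apply/eqP; congr (evalr g _); apply/eqP; rewrite -rpoly_eq !rmorphM /=.
by rewrite -eqr_div ?rpoly_eq0 ?rden_neq0 // -rnum_rden fE.
Qed.

Lemma rcomp_rpoly g p : transcendental g -> rcomp (rpoly p) g = evalr g p.
Proof.
move=> tg; rewrite (@rcompE _ _ p 1) ?oner_neq0 ?rmorph1 ?divr1 //.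
Qed.

Lemma rcompB f h g : transcendental g ->
  rcomp (f - h) g = rcomp f g - rcomp h g.
Proof.
move=> tg; have [p [q [q0 fE]]] := ratfunP f; have [r [s [s0 hE]]] := ratfunP h.
rewrite (rcompE tg q0 fE) (rcompE tg s0 hE).
rewrite (@rcompE _ _ (p * s - r * q) (q * s)) ?mulf_neq0 //.
  by rewrite rmorphB !rmorphM /= -subf_div ?tg.
by rewrite fE hE rmorphB !rmorphM /= subf_div ?rpoly_eq0.
Qed.

Lemma rcompM f h g : transcendental g ->
  rcomp (f * h) g = rcomp f g * rcomp h g.
Proof.
move=> tg; have [p [q [q0 fE]]] := ratfunP f; have [r [s [s0 hE]]] := ratfunP h.
rewrite (rcompE tg q0 fE) (rcompE tg s0 hE).
rewrite (@rcompE _ _ (p * r) (q * s)) ?mulf_neq0 //.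
  by rewrite !rmorphM /= mulf_div.
by rewrite fE hE !rmorphM /= mulf_div.
Qed.

Lemma rcomp_const g (a : F) : transcendental g -> rcomp (rconst a) g = rconst a.
Proof. by move=> tg; rewrite rcomp_rpoly // evalrC. Qed.

Section Composition.
Variables (g : ratfun F) (tg : transcendental g).

(** The proof of transcendence is an argument so that the morphism instances below, which depend on
    it, can be inferred from the term. *)
Definition rcompr (_ : transcendental g) f := rcomp f g.

Let rcompr_zmod_morphism : zmod_morphism (rcompr tg).
Proof. by move=> f h; rewrite /rcompr rcompB. Qed.
Let rcompr_monoid_morphism : monoid_morphism (rcompr tg).
Proof.
split=> [|f h]; rewrite /rcompr ?rcompM //.
by rewrite -(rmorph1 (@rconst F)) rcomp_const.
Qed.
HB.instance Definition _ :=
  GRing.isZmodMorphism.Build _ _ (rcompr tg) rcompr_zmod_morphism.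
HB.instance Definition _ :=
  GRing.isMonoidMorphism.Build _ _ (rcompr tg) rcompr_monoid_morphism.
End Composition.

Lemma rcomp_evalr g h p : transcendental h ->
  rcomp (evalr g p) h = evalr (rcomp g h) p.
Proof.
move=> th; rewrite -!/(rcompr th _).
elim/poly_ind: p => [|p a IH]; first by rewrite !rmorph0.
rewrite [evalr g _]rmorphD [evalr (rcompr th g) _]rmorphD !rmorphM /= !evalrX !evalrC.
by rewrite rmorphD rmorphM /= IH {3}/rcompr rcomp_const.
Qed.

Lemma rcomp_transcendental g h :
  transcendental g -> transcendental h -> transcendental (rcomp g h).
Proof.
move=> tg th p p0; rewrite -rcomp_evalr // -/(rcompr th _) fmorph_eq0.
exact: tg.
Qed.

Lemma rcompA f g h : transcendental g -> transcendental h ->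
  rcomp (rcomp f g) h = rcomp f (rcomp g h).
Proof.
move=> tg th; have [p [q [q0 fE]]] := ratfunP f.
rewrite (rcompE tg q0 fE) (rcompE (rcomp_transcendental tg th) q0 fE).
by rewrite -!rcomp_evalr // -!/(rcompr th _) fmorph_div.
Qed.

Lemma transcendentalX : transcendental ratX.
Proof. by move=> p p0; rewrite evalr_rpoly comp_polyXr rpoly_eq0. Qed.

Lemma rcompXr f : rcomp f ratX = f.
Proof.
rewrite {2}[f]rnum_rden (rcompE transcendentalX (rden_neq0 f) (rnum_rden f)).
by rewrite !evalr_rpoly !comp_polyXr.
Qed.

Lemma rcompX g : transcendental g -> rcomp ratX g = g.
Proof. by move=> tg; rewrite rcomp_rpoly // evalrX. Qed.

End RationalFunctions.

(** * Identities between fractional linear expressions in an abstract field *)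

Section FractionalLinear.
Variable K : fieldType.
Implicit Types (a b c d u : K).

Lemma frac_linK a b c d u : c * u + d != 0 -> a * d - b * c != 0 ->
  (d * ((a * u + b) / (c * u + d)) - b) / (- c * ((a * u + b) / (c * u + d)) + a)
  = u.
Proof.
move=> n0 dt; field.
by rewrite n0; apply: contra_neq dt => <-; ring.
Qed.

Lemma frac_lin_comp a b c d a' b' c' d' u :
  c * u + d != 0 -> c' * ((a * u + b) / (c * u + d)) + d' != 0 ->
  (a' * ((a * u + b) / (c * u + d)) + b') / (c' * ((a * u + b) / (c * u + d)) + d')
  = ((a' * a + b' * c) * u + (a' * b + b' * d)) /
    ((c' * a + d' * c) * u + (c' * b + d' * d)).
Proof.
move=> n0 n1.
have n2 : c' * (a * u + b) + d' * (c * u + d) != 0.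
  apply: contra_neq n1 => e.
  by apply: (mulIf n0); rewrite mul0r mulrDl -mulrA divfK.
have n3 : (c' * a + d' * c) * u + (c' * b + d' * d) != 0.
  by apply: contra_neq n2 => <-; ring.
by field; rewrite n0 n3.
Qed.

Lemma frac_lin_eq a b c d u (k : K) : c * u + d != 0 ->
  (a * u + b) / (c * u + d) = k -> (a - k * c) * u + (b - k * d) = 0.
Proof.
move=> n0 /(canRL (divfK n0)) /eqP; rewrite -subr_eq0 => /eqP <-; ring.
Qed.

End FractionalLinear.

(** * Degree-one functions, and equivalence as an equivalence relation *)

Section Moebius.
Variable F : finFieldType.
Implicit Types (f g h u v : ratfun F) (p q n d : {poly F}).

Local Notation ratX := (rpoly 'X : ratfun F).

(** Acting on an arbitrary [u] turns post-composition into plain field arithmetic; the value at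
    [ratX] serves for pre-composition. *)
Definition moebius (a b c d : F) u : ratfun F :=
  (rconst a * u + rconst b) / (rconst c * u + rconst d).

Lemma linear_poly_neq0 (c d : F) : (c != 0) || (d != 0) ->
  c *: 'X + d%:P != 0 :> {poly F}.
Proof.
apply: contraL => /eqP e.
have := congr1 (fun p => p`_0) e; have := congr1 (fun p => p`_1) e.
rewrite !coefD !coefZ !coefX !coefC /= mulr0 mulr1 addr0 add0r => -> ->.
by rewrite eqxx.
Qed.

Lemma linear_transcendental_neq0 u (c d : F) : transcendental u ->
  (c != 0) || (d != 0) -> rconst c * u + rconst d != 0.
Proof.
move=> tu /linear_poly_neq0/tu.
by rewrite rmorphD /= evalrZ evalrX evalrC.
Qed.

Lemma det_row2 (a b c d : F) : a * d - b * c != 0 -> (c != 0) || (d != 0).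
Proof.
apply: contraR; rewrite negb_or !negbK => /andP[/eqP -> /eqP ->].
by rewrite !mulr0 subrr.
Qed.

Lemma moebius_den_neq0 u (a b c d : F) : transcendental u ->
  a * d - b * c != 0 -> rconst c * u + rconst d != 0.
Proof. by move=> tu /det_row2; exact: linear_transcendental_neq0. Qed.

Lemma moebiusK u (a b c d : F) : transcendental u -> a * d - b * c != 0 ->
  moebius d (- b) (- c) a (moebius a b c d u) = u.
Proof.
move=> tu dt; have n0 := moebius_den_neq0 tu dt.
have k0 : rconst (a * d - b * c) != 0 by rewrite fmorph_eq0.
move: k0; rewrite /moebius !(rmorphN, rmorphB, rmorphM) /= => k0.
exact (frac_linK n0 k0).
Qed.

(** A constant value [k] would give a linear relation for [u] with coefficients [a - k c] and
    [b - k d], which vanish together only if the determinant does. *)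
Lemma moebius_transcendental u (a b c d : F) : transcendental u ->
  a * d - b * c != 0 -> transcendental (moebius a b c d u).
Proof.
move=> tu dt; apply: rdeg_transcendental; apply: nonconst_rdeg => k.
apply/eqP => e; have n0 := moebius_den_neq0 tu dt.
have : rconst (a - k * c) * u + rconst (b - k * d) == 0.
  by rewrite !rmorphB !rmorphM /= (frac_lin_eq n0 e).
apply/negP; apply: linear_transcendental_neq0 => //.
apply: contraR dt; rewrite negb_or !negbK !subr_eq0 => /andP[/eqP -> /eqP ->].
by apply/eqP; ring.
Qed.

Lemma moebius_comp u (a b c d a' b' c' d' : F) : transcendental u ->
  a * d - b * c != 0 -> a' * d' - b' * c' != 0 ->
  moebius a' b' c' d' (moebius a b c d u) =
  moebius (a' * a + b' * c) (a' * b + b' * d)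
          (c' * a + d' * c) (c' * b + d' * d) u.
Proof.
move=> tu dt dt'; have n0 := moebius_den_neq0 tu dt.
have n1 := moebius_den_neq0 (moebius_transcendental tu dt) dt'.
rewrite /moebius !(rmorphD (@rconst F), rmorphM (@rconst F)).
exact (frac_lin_comp _ _ n0 n1).
Qed.

Lemma moebius_comp_det (a b c d a' b' c' d' : F) :
  a * d - b * c != 0 -> a' * d' - b' * c' != 0 ->
  (a' * a + b' * c) * (c' * b + d' * d) - (a' * b + b' * d) * (c' * a + d' * c)
  != 0.
Proof.
move=> dt dt'; have := mulf_neq0 dt dt'; apply: contra_neq => <-; ring.
Qed.

Lemma rcomp_moebius f g (a b c d : F) : transcendental g ->
  rcomp (moebius a b c d f) g = moebius a b c d (rcomp f g).
Proof.
move=> tg; rewrite -!/(rcompr tg _) /moebius fmorph_div !rmorphD !rmorphM /=.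
by rewrite /rcompr !rcomp_const.
Qed.

Lemma in_PGL2P (phi : ratfun F) : in_PGL2 phi <->
  exists a b c d : F, a * d - b * c != 0 /\ phi = moebius a b c d ratX.
Proof.
have lin (a b : F) : rpoly (a *: 'X + b%:P) = rconst a * ratX + rconst b.
  by rewrite -mul_polyC rmorphD rmorphM.
by split=> -[a [b [c [d [dt ->]]]]]; exists a, b, c, d; rewrite /moebius !lin.
Qed.

(** Both degree-one functions become explicit matrices, and the positive degree of [g] is recovered
    from that of [f], since Moebius maps and composition preserve transcendence. *)
Lemma requivP f g : requiv f g <-> [/\ transcendental f &
  exists a b c d A B C E : F, [/\ a * d - b * c != 0, A * E - B * C != 0 &
    g = moebius A B C E (rcomp f (moebius a b c d ratX))]].
Proof.
have tX := @transcendentalX F.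
split.
  move=> [/rdeg_transcendental tf _ [psi [phi [/in_PGL2P[A [B [C [E [dt' ->]]]]]]]]].
  move=> /in_PGL2P[a [b [c [d [dt ->]]]]] ->; split=> //.
  exists a, b, c, d, A, B, C, E; split=> //.
  have tp := moebius_transcendental tX dt.
  have tfp := rcomp_transcendental tf tp.
  by rewrite rcomp_moebius // rcompX.
move=> [tf [a [b [c [d [A [B [C [E [dt dt' ->]]]]]]]]]].
have tp := moebius_transcendental tX dt.
have tfp := rcomp_transcendental tf tp.
split; first exact: transcendental_rdeg.
  exact/transcendental_rdeg/moebius_transcendental.
exists (moebius A B C E ratX), (moebius a b c d ratX); split.
- by apply/in_PGL2P; exists A, B, C, E.
- by apply/in_PGL2P; exists a, b, c, d.
- by rewrite rcomp_moebius // rcompX.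
Qed.

Lemma requiv_refl f : transcendental f -> requiv f f.
Proof.
have mob1 v : moebius 1 0 0 1 v = v.
  by rewrite /moebius rmorph0 rmorph1 mul1r addr0 mul0r add0r divr1.
have det1 : 1 * 1 - 0 * 0 != 0 :> F by rewrite mulr1 mulr0 subr0 oner_neq0.
move=> tf; apply/requivP; split=> //.
by exists 1, 0, 0, 1, 1, 0, 0, 1; rewrite !mob1 rcompXr.
Qed.

Lemma requiv_sym f g : requiv f g -> requiv g f.
Proof.
move=> /requivP[tf [a [b [c [d [A [B [C [E [dt dt' ->]]]]]]]]]].
have tX := @transcendentalX F.
have tp := moebius_transcendental tX dt.
have tfp := rcomp_transcendental tf tp.
have dinv (x y z t : F) : x * t - y * z != 0 -> t * x - (- y) * (- z) != 0.
  by apply: contra_neq => <-; ring.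
have tq := moebius_transcendental tX (dinv _ _ _ _ dt).
apply/requivP; split; first exact: moebius_transcendental.
exists d, (- b), (- c), a, E, (- B), (- C), A; split; try exact: dinv.
rewrite (rcomp_moebius _ _ _ _ _ tq) (moebiusK (rcomp_transcendental tfp tq) dt').
rewrite (rcompA _ tp tq) (rcomp_moebius _ _ _ _ _ tq) (rcompX tq).
suff -> : moebius a b c d (moebius d (- b) (- c) a ratX) = ratX by rewrite rcompXr.
by rewrite -{2}[ratX](moebiusK tX (dinv _ _ _ _ dt)) !opprK.
Qed.

Lemma requiv_trans f g h : requiv f g -> requiv g h -> requiv f h.
Proof.
move=> /requivP[tf [a [b [c [d [A [B [C [E [dt dt' ->]]]]]]]]]].
move=> /requivP[tg [a1 [b1 [c1 [d1 [A1 [B1 [C1 [E1 [dt1 dt1' ->]]]]]]]]]].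
have tX := @transcendentalX F.
have tp := moebius_transcendental tX dt.
have tp1 := moebius_transcendental tX dt1.
apply/requivP; split=> //.
(* Matrices multiply in opposite orders on the two sides: the new inner matrix goes on the right,
   the new outer one on the left. *)
exists (a * a1 + b * c1), (a * b1 + b * d1), (c * a1 + d * c1), (c * b1 + d * d1).
exists (A1 * A + B1 * C), (A1 * B + B1 * E), (C1 * A + E1 * C), (C1 * B + E1 * E).
split; try exact: moebius_comp_det.
have tpp1 := moebius_transcendental tp1 dt.
rewrite -(moebius_comp tX dt1 dt) (rcomp_moebius _ _ _ _ _ tp1).
rewrite (rcompA _ tp tp1) (rcomp_moebius _ _ _ _ _ tp1) (rcompX tp1).
by rewrite (moebius_comp (rcomp_transcendental tf tpp1) dt' dt1').
Qed.

End Moebius.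

(** * Cubic forms and comparison of coefficients *)

Section Cubics.
Variable K : fieldType.
Implicit Types (p q L M : {poly K}) (a b c d : K).

Definition cubicp (c3 c2 c1 c0 : K) : {poly K} :=
  c3%:P * 'X^3 + c2%:P * 'X^2 + c1%:P * 'X + c0%:P.

Lemma coef_cubicp c3 c2 c1 c0 :
  [/\ (cubicp c3 c2 c1 c0)`_3 = c3, (cubicp c3 c2 c1 c0)`_2 = c2,
      (cubicp c3 c2 c1 c0)`_1 = c1 & (cubicp c3 c2 c1 c0)`_0 = c0].
Proof. by rewrite /cubicp; split; rewrite !coefE /=; ring. Qed.

Lemma cubicp_coef p : (size p <= 4)%N -> p = cubicp p`_3 p`_2 p`_1 p`_0.
Proof.
move=> sp; have [e3 e2 e1 e0] := coef_cubicp p`_3 p`_2 p`_1 p`_0.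
apply/polyP => -[|[|[|[|i]]]] //.
rewrite nth_default ?(leq_trans sp) // /cubicp !coefE /=; ring.
Qed.

Lemma size_cubicp c3 c2 c1 c0 : (size (cubicp c3 c2 c1 c0) <= 4)%N.
Proof.
apply/leq_sizeP => -[|[|[|[|i]]]] // _; rewrite /cubicp !coefE /=; ring.
Qed.

(* [cubic_form x y p] is [y ^+ 3 * p.[x / y]], extended to [y = 0]. *)
Definition cubic_form (x y : K) p : K :=
  p`_0 * y ^+ 3 + p`_1 * (x * y ^+ 2) + p`_2 * (x ^+ 2 * y) + p`_3 * x ^+ 3.

(** For [size p <= 4] this is [M ^+ 3 * p(L / M)]; the exponent 3 is kept even when [p] has smaller
    degree, so that infinity can be a zero. *)
Definition cubic_formp L M p : {poly K} :=
  p`_0 *: M ^+ 3 + p`_1 *: (L * M ^+ 2) + p`_2 *: (L ^+ 2 * M) + p`_3 *: L ^+ 3.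

(** The extreme coefficients are left as values of the form at [a / c] and [b / d], the images of
    infinity and 0. *)
Lemma cubic_formp_linear a b c d p :
  cubic_formp (a *: 'X + b%:P) (c *: 'X + d%:P) p =
  cubicp (cubic_form a c p)
    (p`_0 * (3%:R * c ^+ 2 * d) + p`_1 * (b * c ^+ 2 + 2%:R * a * c * d) +
     p`_2 * (a ^+ 2 * d + 2%:R * a * b * c) + p`_3 * (3%:R * a ^+ 2 * b))
    (p`_0 * (3%:R * c * d ^+ 2) + p`_1 * (2%:R * b * c * d + a * d ^+ 2) +
     p`_2 * (2%:R * a * b * d + b ^+ 2 * c) + p`_3 * (3%:R * a * b ^+ 2))
    (cubic_form b d p).
Proof. by rewrite /cubic_formp /cubicp /cubic_form -!mul_polyC; ring. Qed.

Lemma horner_cubic_form p (x y : K) : (size p <= 4)%N -> y != 0 ->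
  cubic_form x y p = y ^+ 3 * p.[x / y].
Proof.
move=> sp y0; rewrite {2}(cubicp_coef sp) /cubicp /cubic_form.
rewrite !(hornerD, hornerM, hornerC, hornerXn, hornerX).
by field.
Qed.

(** Coprimality excludes common zeros at finite points; the condition on the coefficients of degree
    3 excludes infinity. *)
Lemma cubic_form_coprime p q (x y : K) : (size p <= 4)%N -> (size q <= 4)%N ->
  coprimep p q -> (p`_3 != 0) || (q`_3 != 0) -> (x != 0) || (y != 0) ->
  cubic_form x y q = 0 -> cubic_form x y p != 0.
Proof.
move=> sp sq cpq pq3 xy q0; apply/eqP => p0.
have [y0|y0] := eqVneq y 0.
  move: xy p0 q0 pq3; rewrite /cubic_form y0 eqxx orbF => x0.
  rewrite !expr0n /= !mulr0 !add0r => /eqP + /eqP.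
  have x3 := expf_neq0 3 x0.
  by rewrite !(mulIr_eq0 _ (mulIf x3)) => -> ->.
move: p0 q0; rewrite !horner_cubic_form // => /eqP + /eqP.
have y3 := expf_neq0 3 y0.
rewrite !(mulrI_eq0 _ (mulfI y3)) => rp.
by apply/negP; apply: (coprimep_root cpq).
Qed.

Lemma degree6_eq0_coefs (c6 c5 c4 c3 c2 c1 c0 : K) :
  c6%:P * 'X^6 + c5%:P * 'X^5 + c4%:P * 'X^4 + c3%:P * 'X^3 + c2%:P * 'X^2 +
    c1%:P * 'X + c0%:P = 0 :> {poly K} ->
  [/\ [/\ c6 = 0, c5 = 0, c4 = 0 & c3 = 0], c2 = 0, c1 = 0 & c0 = 0].
Proof.
move=> e; have ei i := congr1 (fun p => p`_i) e.
move: (ei 0%N) (ei 1%N) (ei 2) (ei 3) (ei 4) (ei 5) (ei 6).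
rewrite !coefE /= !(mulr0, mulr1, addr0, add0r).
by split.
Qed.

(** The conclusion says that both cubics lie in the span of [cubicp 1 beta 0 t] and ['X]. The first
    is in fact a multiple of ['X], but linear relations shared by both cubics are what can be
    transported through a change of basis. *)
Lemma cubic_fraction_coefs (p3 p2 p1 p0 q3 q2 q1 q0 beta t : K) :
  t != 0 ->
  cubicp 1 beta 0 t * cubicp p3 p2 p1 p0 = 'X * cubicp q3 q2 q1 q0 ->
  [/\ p2 = beta * p3, p0 = t * p3, q2 = beta * q3 & q0 = t * q3].
Proof.
move=> t0 e.
have := @degree6_eq0_coefs p3 (p2 + beta * p3) (p1 + beta * p2 - q3)
  (p0 + beta * p1 + t * p3 - q2) (beta * p0 + t * p2 - q1) (t * p1 - q0) (t * p0).
case.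
  have <- : cubicp 1 beta 0 t * cubicp p3 p2 p1 p0 - 'X * cubicp q3 q2 q1 q0 = 0.
    by rewrite e subrr.
  by rewrite /cubicp; ring.
case=> -> /eqP; rewrite mulr0 addr0 => /eqP ->.
rewrite !mulr0 addr0 => /eqP + + _ /eqP + /eqP; rewrite mulf_eq0 (negbTE t0) /=.
rewrite !subr_eq0 => /eqP q3E e3 /eqP q0E /eqP p0E.
split=> //; last by rewrite -q0E q3E.
by move/eqP: e3; rewrite p0E add0r addr0 subr_eq0 q3E => /eqP.
Qed.

(* The case [c = 0] is that of a substitution fixing the double point; otherwise
   [a / c] is another critical point, which forces
   [t * c ^+ 3 = 2 * a ^+ 3 + beta * a ^+ 2 * c]. *)
Lemma cubic_parameters (a b c d beta t beta' t' : K) :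
  a * d - b * c != 0 -> t' != 0 ->
  b * c ^+ 2 + 2%:R * a * c * d = beta' * (a * c ^+ 2) ->
  b * d ^+ 2 = t' * (a * c ^+ 2) ->
  t * (3%:R * c ^+ 2 * d) + beta * (a ^+ 2 * d + 2%:R * a * b * c)
    + 3%:R * a ^+ 2 * b
  = beta' * (t * c ^+ 3 + beta * (a ^+ 2 * c) + a ^+ 3) ->
  t * d ^+ 3 + beta * (b ^+ 2 * d) + b ^+ 3
  = t' * (t * c ^+ 3 + beta * (a ^+ 2 * c) + a ^+ 3) ->
  exists2 r, r != 0 & beta' = beta * r /\ t' = t * r ^+ 3.
Proof.
move=> dt t'0 e1 e2 e3 e4.
suff [r [bE tE]] : exists r, beta' = beta * r /\ t' = t * r ^+ 3.
  by exists r => //; apply: contra_neq t'0 => r0; rewrite tE r0 expr0n mulr0.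
have [a0|a0] := eqVneq a 0.
  move: e1 dt; rewrite a0 !(mul0r, mulr0, addr0, sub0r) oppr_eq0 => /eqP.
  by rewrite mulf_eq0 sqrf_eq0 [b * c == 0]mulf_eq0 => ->.
have [c0|c0] := eqVneq c 0.
  move: dt e2 e3 e4; rewrite c0 !(expr0n, mulr0, mul0r, subr0, addr0, add0r) /=.
  rewrite mulf_eq0 (negbTE a0) /= => d0 /eqP.
  rewrite mulf_eq0 expf_eq0 /= (negbTE d0) orbF => /eqP ->.
  rewrite !(expr0n, mulr0, mul0r, addr0, add0r) /= => e3 e4.
  exists (d / a); split.
    by apply: (mulIf (expf_neq0 3 a0)); rewrite -e3; field.
  by apply: (mulIf (expf_neq0 3 a0)); rewrite -e4; field.
(* The three zeros of the fiber through [a / c], namely [a / c] twice and [b / d], sum to [- beta];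
   this is [bE] below. Inserted into [e1'] it gives [beta' * a = - beta * d], which dictates this
   value. *)
exists (- d / a).
have e1' : b * c + 2%:R * a * d = beta' * (a * c).
  by apply: (mulIf c0); rewrite -!mulrA -expr2 -e1; ring.
have tE : t * c ^+ 3 = 2%:R * a ^+ 3 + beta * a ^+ 2 * c.
  apply/eqP; rewrite -subr_eq0; apply/eqP; apply: (mulfI dt); rewrite mulr0.
  (* Eliminating [beta'] between [e1'] and [e3] leaves the determinant as a factor. *)
  transitivity (a * c * ((t * (3%:R * c ^+ 2 * d) +
    beta * (a ^+ 2 * d + 2%:R * a * b * c) + 3%:R * a ^+ 2 * b) -
    beta' * (t * c ^+ 3 + beta * (a ^+ 2 * c) + a ^+ 3)) -
    (t * c ^+ 3 + beta * (a ^+ 2 * c) + a ^+ 3) *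
    (b * c + 2%:R * a * d - beta' * (a * c))); first by ring.
  by rewrite e1' e3 !subrr !mulr0 subr0.
have bE : b * c = - (2%:R * a + beta * c) * d.
  apply/eqP; rewrite -subr_eq0; apply/eqP.
  apply: (mulfI (mulf_neq0 a0 (expf_neq0 2 dt))); rewrite mulr0.
  (* Here [t'] is eliminated between [e2] and [e4], and the last summand vanishes by [tE]. *)
  transitivity (a * c ^+ 3 * (t * d ^+ 3 + beta * (b ^+ 2 * d) + b ^+ 3 -
     t' * (t * c ^+ 3 + beta * (a ^+ 2 * c) + a ^+ 3))
     - c * (t * c ^+ 3 + beta * (a ^+ 2 * c) + a ^+ 3) *
       (b * d ^+ 2 - t' * (a * c ^+ 2))
     + (2%:R * a ^+ 3 + beta * a ^+ 2 * c - t * c ^+ 3) *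
       (a * d ^+ 3 - b * c * d ^+ 2)); first by ring.
  by rewrite e2 e4 tE !subrr !(mulr0, mul0r) subr0 addr0.
split.
  apply: (mulIf (mulf_neq0 a0 c0)); rewrite -e1' bE; field.
  by [].
apply: (mulIf (mulf_neq0 (expf_neq0 3 a0) (expf_neq0 3 c0))).
transitivity (a ^+ 2 * c * (t' * (a * c ^+ 2))); first by ring.
rewrite -e2.
transitivity (a ^+ 2 * d ^+ 2 * (b * c)); first by ring.
rewrite bE.
transitivity (- (t * c ^+ 3) * d ^+ 3); first by rewrite tE; ring.
by field.
Qed.

End Cubics.

(** * Equivalences between functions of the form [(X^3 + beta X^2 + t) / X] *)

Section CubicFractions.
Variable F : finFieldType.
Implicit Types (f g : ratfun F) (p q L M : {poly F}) (beta t : F).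

Local Notation ratX := (rpoly 'X : ratfun F).

Lemma cubic_dehomogenize (K : fieldType) (c3 c2 c1 c0 x y : K) : y != 0 ->
  (c3 * (x / y) ^+ 3 + c2 * (x / y) ^+ 2 + c1 * (x / y) + c0) * y ^+ 3 =
  c0 * y ^+ 3 + c1 * (x * y ^+ 2) + c2 * (x ^+ 2 * y) + c3 * x ^+ 3.
Proof. by move=> y0; field. Qed.

Lemma frac_lin_div (K : fieldType) (a b c d x y : K) : y != 0 ->
  c * (x / y) + d != 0 ->
  c * x + d * y != 0 /\
  (a * (x / y) + b) / (c * (x / y) + d) = (a * x + b * y) / (c * x + d * y).
Proof.
move=> y0 n0; have n1 : c * x + d * y != 0.
  apply: contra_neq n0 => e; apply: (mulIf y0).
  by rewrite mul0r mulrDl -mulrA divfK.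
by split=> //; field; rewrite y0 n1.
Qed.

Lemma div_div_cancel (K : fieldType) (x y z : K) :
  z != 0 -> x / z / (y / z) = x / y.
Proof. by move=> z0; rewrite -mulf_div divff ?mulr1 // invr_neq0. Qed.

Lemma rpoly_div_eq p q L M : q != 0 -> M != 0 ->
  (rpoly p / rpoly q == rpoly L / rpoly M) = (p * M == L * q).
Proof.
by move=> q0 M0; rewrite eqr_div ?rpoly_eq0 // -!rmorphM rpoly_eq.
Qed.

Lemma evalr_cubic_formp p L M : (size p <= 4)%N -> M != 0 ->
  evalr (rpoly L / rpoly M) p * rpoly M ^+ 3 = rpoly (cubic_formp L M p).
Proof.
move=> sp M0; have m0 : rpoly M != 0 by rewrite rpoly_eq0.
have homE : rpoly (cubic_formp L M p) =
    rconst p`_0 * rpoly M ^+ 3 + rconst p`_1 * (rpoly L * rpoly M ^+ 2) +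
    rconst p`_2 * (rpoly L ^+ 2 * rpoly M) + rconst p`_3 * rpoly L ^+ 3.
  by rewrite /cubic_formp -!mul_polyC !(rmorphD, rmorphM, rmorphXn).
rewrite homE {1}(cubicp_coef sp) /cubicp !(rmorphD, rmorphM, rmorphXn) /=.
rewrite !evalrC !evalrX.
exact (cubic_dehomogenize _ _ _ _ _ m0).
Qed.

Lemma moebius_ratX (a b c d : F) :
  moebius a b c d ratX = rpoly (a *: 'X + b%:P) / rpoly (c *: 'X + d%:P).
Proof. by rewrite /moebius -!mul_polyC !rmorphD !rmorphM. Qed.

(** The common denominator [M ^+ 3] cancels, so the inner substitution acts on numerator and
    denominator as on cubic forms, and the outer one by linear combinations. *)
Lemma moebius_rcomp_cubic f p q (a b c d A B C E : F) :
  transcendental f -> (size p <= 4)%N -> (size q <= 4)%N -> q != 0 ->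
  f = rpoly p / rpoly q -> a * d - b * c != 0 -> A * E - B * C != 0 ->
  let P := cubic_formp (a *: 'X + b%:P) (c *: 'X + d%:P) p in
  let Q := cubic_formp (a *: 'X + b%:P) (c *: 'X + d%:P) q in
  C *: P + E *: Q != 0 /\
  moebius A B C E (rcomp f (moebius a b c d ratX)) =
    rpoly (A *: P + B *: Q) / rpoly (C *: P + E *: Q).
Proof.
move=> tf sp sq q0 fE dt dt'.
set L := a *: 'X + b%:P; set M := c *: 'X + d%:P => P Q.
have tphi := moebius_transcendental (@transcendentalX F) dt.
have tfphi := rcomp_transcendental tf tphi.
have M0 : M != 0 by apply: linear_poly_neq0; apply: det_row2 dt.
have m0 : rpoly M ^+ 3 != 0 by rewrite expf_neq0 // rpoly_eq0.
have phiE : moebius a b c d ratX = rpoly L / rpoly M := moebius_ratX a b c d.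
have hP : evalr (moebius a b c d ratX) p = rpoly P / rpoly M ^+ 3.
  by apply: (canRL (mulfK m0)); rewrite phiE evalr_cubic_formp.
have hQ : evalr (moebius a b c d ratX) q = rpoly Q / rpoly M ^+ 3.
  by apply: (canRL (mulfK m0)); rewrite phiE evalr_cubic_formp.
have Q0 : rpoly Q != 0.
  by apply: contra_neq (tphi _ q0) => Q0; rewrite hQ Q0 mul0r.
have vE : rcomp f (moebius a b c d ratX) = rpoly P / rpoly Q.
  rewrite (rcompE tphi q0 fE) hP hQ; exact (div_div_cancel _ _ m0).
have := moebius_den_neq0 tfphi dt'; rewrite /moebius vE => den0.
have [n0 e] := frac_lin_div (rconst A) (rconst B) Q0 den0.
have lin (x y : F) : rpoly (x *: P + y *: Q) = rconst x * rpoly P + rconst y * rpoly Q.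
  by rewrite -!mul_polyC rmorphD !rmorphM.
split; last by rewrite !lin; exact e.
by rewrite -rpoly_eq0 lin.
Qed.

Definition cubic beta t : ratfun F :=
  rpoly (cubicp 1 beta 0 t) / rpoly 'X.

Lemma coprime_cubicX beta t : t != 0 -> coprimep (cubicp 1 beta 0 t) 'X.
Proof.
move=> t0; have := coprimep_XsubC (cubicp 1 beta 0 t) 0; rewrite subr0 => ->.
rewrite /root /cubicp !(hornerD, hornerM, hornerC, hornerXn, hornerX).
by rewrite !(mulr0, add0r).
Qed.

Lemma size_cubicp1 beta t : size (cubicp 1 beta 0 t) = 4%N.
Proof.
have [c3 _ _ _] := coef_cubicp 1 beta 0 t.
apply/anti_leq; rewrite size_cubicp ltnNge; apply: contra_eqN c3 => sz.
by rewrite nth_default // eq_sym oner_neq0.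
Qed.

Lemma cubic_rnum_rden beta t : t != 0 ->
  exists2 k : F, k != 0 & rnum (cubic beta t) = k *: cubicp 1 beta 0 t /\
    rden (cubic beta t) = k *: 'X.
Proof.
move=> t0; have X0 : 'X != 0 :> {poly F} by rewrite polyX_eq0.
exact (rnum_rden_coprime X0 (coprime_cubicX beta t0) erefl).
Qed.

Lemma cubic_class_II beta t : t != 0 -> class_II (cubic beta t).
Proof.
move=> t0; have [k k0 [nE dE]] := cubic_rnum_rden beta t0.
split; first by rewrite /rdeg nE dE !size_scale // size_cubicp1 size_polyX.
exists None.
suff -> : rfiber (cubic beta t) None = [set None; Some 0]%SET by rewrite cards2.
apply/setP => -[x|]; rewrite !inE /reval nE dE.
  rewrite rootZ // rootX; case: (eqVneq x 0) => [->|x0].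
    by rewrite /= !eqxx.
  by apply/esym; rewrite /=; apply: contraNF x0 => /eqP[->].
by rewrite !size_scale // size_cubicp1 size_polyX.
Qed.

Lemma cubic_transcendental beta t : t != 0 -> transcendental (cubic beta t).
Proof. by move/(cubic_class_II beta) => [d _]; apply: rdeg_transcendental; rewrite d. Qed.

Lemma requiv_cubic_parameters beta t beta' t' : t != 0 -> t' != 0 ->
  requiv (cubic beta t) (cubic beta' t') ->
  exists2 r, r != 0 & beta' = beta * r /\ t' = t * r ^+ 3.
Proof.
move=> t0 t'0 /requivP[tf [a [b [c [d [A [B [C [E [dt dt' e]]]]]]]]]].
have X0 : 'X != 0 :> {poly F} by rewrite polyX_eq0.
have := moebius_rcomp_cubic tf (size_cubicp 1 beta 0 t) _ X0 erefl dt dt'.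
rewrite size_polyX => /(_ isT) [n0]; rewrite -e => /eqP.
rewrite /cubic rpoly_div_eq // => /eqP.
rewrite !cubic_formp_linear.
have [x3 x2 x1 x0] := coef_cubicp 1 beta 0 t.
rewrite /cubic_form x3 x2 x1 x0 !coefX /= !(mul0r, mul1r, addr0, add0r).
set n3 := _ + a ^+ 3; set n2 := _ + 3%:R * a ^+ 2 * b.
set n1 := _ + 3%:R * a * b ^+ 2; set m0 := _ + b ^+ 3.
set d2 := b * c ^+ 2 + _; set d1 := 2%:R * b * c * d + _.
have lin x y : x *: cubicp n3 n2 n1 m0 + y *: cubicp (a * c ^+ 2) d2 d1 (b * d ^+ 2)
   = cubicp (x * n3 + y * (a * c ^+ 2)) (x * n2 + y * d2) (x * n1 + y * d1)
            (x * m0 + y * (b * d ^+ 2)).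
  by rewrite /cubicp -!mul_polyC; ring.
rewrite !lin => eq.
(* The relations hold for the two combinations with coefficients [A, B] and [C, E]. This matrix is
   invertible, so [elim], which is Cramer's rule, carries them over to the substituted cubics
   themselves. *)
have [] := cubic_fraction_coefs t'0 (etrans eq (mulrC _ _)).
set y3 := a * c ^+ 2; set y0 := b * d ^+ 2 => e1 e2 e3 e4.
have elim (u v u' v' : F) : C * u + E * v = C * u' + E * v' ->
    A * u + B * v = A * u' + B * v' -> u = u' /\ v = v'.
  move=> h1 h2; split; apply: (mulfI dt').
    transitivity (E * (A * u + B * v) - B * (C * u + E * v)); first by ring.
    by rewrite h1 h2; ring.
  transitivity (A * (C * u + E * v) - C * (A * u + B * v)); first by ring.
  by rewrite h1 h2; ring.
have [h1 h2] : n2 = beta' * n3 /\ d2 = beta' * y3.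
  by apply: elim; rewrite ?e1 ?e3; ring.
have [h3 h4] : m0 = t' * n3 /\ y0 = t' * y3.
  by apply: elim; rewrite ?e2 ?e4; ring.
exact: (cubic_parameters dt t'0 h2 h4 h1 h3).
Qed.

End CubicFractions.

(** * Reduction of a Class II function to [(X^3 + beta X^2 + t) / X] *)

Section NormalForm.
Variable F : finFieldType.
Implicit Types (f g : ratfun F) (p q M W : {poly F}) (beta t : F).

Local Notation ratX := (rpoly 'X : ratfun F).

Lemma requiv_cubic_scale beta t r : t != 0 -> r != 0 ->
  requiv (cubic beta t) (cubic (beta * r) (t * r ^+ 3)).
Proof.
move=> t0 r0; have tf := cubic_transcendental beta t0.
apply/requivP; split; first exact tf.
have X0 : 'X != 0 :> {poly F} by rewrite polyX_eq0.
have dt : 1 * r - 0 * 0 != 0 :> F by rewrite mul1r mulr0 subr0.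
have dt' : r ^+ 2 * 1 - 0 * 0 != 0 :> F.
  by rewrite mulr1 mulr0 subr0 expf_neq0.
(* The function [r ^+ 2 * f(X / r)], where [r ^+ 2] makes the numerator monic over ['X] again. *)
exists 1, 0, 0, r, (r ^+ 2), 0, 0, 1; split; [exact dt|exact dt'|].
have := moebius_rcomp_cubic tf (size_cubicp 1 beta 0 t) _ X0 erefl dt dt'.
rewrite size_polyX => /(_ isT) [n0 ->]; apply/eqP.
rewrite /cubic rpoly_div_eq //.
have [x3 x2 x1 x0] := coef_cubicp 1 beta 0 t.
rewrite /cubic_formp x3 x2 x1 x0 !coefX /= /cubicp -!mul_polyC.
by apply/eqP; ring.
Qed.

(* [None] is a zero of the homogenization of degree 3 of [W]. *)
Definition proj_zero W (x : option F) : bool :=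
  if x is Some r then root W r else W`_3 == 0.

Lemma root_cubicp W (x : F) : (size W <= 4)%N -> root W x =
  (W`_3 * x ^+ 3 + W`_2 * x ^+ 2 + W`_1 * x + W`_0 == 0).
Proof.
move=> sW; rewrite /root {1}(cubicp_coef sW) /cubicp.
rewrite !(hornerD, hornerM, hornerC, hornerXn, hornerX).
by congr (_ == 0); ring.
Qed.

(** As a form of degree 3, [k%:P * 'X] has a double zero at infinity and a simple zero at 0. *)
Definition has_two_point_form W := exists k a b c d : F,
  [/\ k != 0, a * d - b * c != 0 &
      cubic_formp (a *: 'X + b%:P) (c *: 'X + d%:P) W = k%:P * 'X].

Lemma two_point_form_finite W (k r s : F) : k != 0 -> r != s ->
  (size W <= 4)%N -> W`_3 = k -> W`_2 = - (k * (2%:R * r + s)) ->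
  W`_1 = k * (r ^+ 2 + 2%:R * r * s) -> W`_0 = - (k * r ^+ 2 * s) ->
  has_two_point_form W.
Proof.
move=> k0; rewrite -subr_eq0 => rs sW w3 w2 w1 w0.
(* Here [W = k (X - r)^2 (X - s)]. Under [(r X + s) / (X + 1)] the factors [X - r] and [X - s]
   become [s - r] and [(r - s) X] over [X + 1]. *)
exists (k * (r - s) ^+ 3), r, s, 1, 1; split.
- by rewrite mulf_neq0 // expf_neq0.
- by rewrite !mulr1.
- rewrite /cubic_formp w3 w2 w1 w0 -!mul_polyC; ring.
Qed.

Lemma two_point_form W : (size W <= 4)%N ->
  #|[set x | proj_zero W x]%SET| = 2%N -> has_two_point_form W.
Proof.
move=> sW /eqP /cards2P[x [y [xy S]]].
have zx z : proj_zero W z = (z == x) || (z == y).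
  by have := congr1 (fun A : {set option F} => z \in A) S; rewrite !inE.
(* With a zero at infinity, [W] has degree at most 2. If it is linear, infinity is the double zero;
   if it is quadratic, its second root is rational and finite, hence equal to [r]. *)
have inf r : (forall z, proj_zero W z = (z == None) || (z == Some r)) ->
    has_two_point_form W.
  move=> zr; have /eqP w3 : proj_zero W None by rewrite zr eqxx.
  have : proj_zero W (Some r) by rewrite zr eqxx orbT.
  rewrite /= root_cubicp // w3 mul0r add0r => /eqP rr.
  have [w2|w2] := eqVneq W`_2 0.
    move: rr; rewrite w2 mul0r add0r => /eqP; rewrite addrC addr_eq0 => /eqP w0.
    have w1 : W`_1 != 0.
      (* Otherwise [W = 0], and [r + 1] would be a third zero. *)
      apply/eqP => w1; have := zr (Some (r + 1)).
      rewrite /= root_cubicp // w3 w2 w0 w1 !mul0r oppr0 !addr0 eqxx => /esym/eqP.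
      case=> /eqP; rewrite -subr_eq0 addrC addKr oner_eq0 //.
    exists (W`_1), 1, r, 0, 1; split=> //.
      by rewrite mulr1 mulr0 subr0 oner_neq0.
    rewrite /cubic_formp w3 w2 w0 -!mul_polyC; ring.
  have w0 : W`_0 = - (W`_2 * r ^+ 2 + W`_1 * r).
    by apply/eqP; rewrite -addr_eq0 addrC rr.
  have w1 : W`_1 = - (2%:R * W`_2 * r).
    have : proj_zero W (Some (- (W`_1 / W`_2 + r))).
      rewrite /= root_cubicp // w3 w0; apply/eqP; field.
      by [].
    rewrite zr /= => /eqP[] e; apply/eqP; rewrite -addr_eq0; apply/eqP.
    transitivity (W`_2 * (r - (- (W`_1 / W`_2 + r)))); first by field.
    by rewrite e subrr mulr0.
  exists (W`_2), r, 1, 1, 0; split=> //.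
    by rewrite mulr0 mulr1 sub0r oppr_eq0 oner_neq0.
  rewrite /cubic_formp w3 w0 w1 -!mul_polyC; ring.
case: x y xy S zx => [r|] [s|] xy S zx.
- have rs : r != s by apply: contra_neq xy => ->.
  have w3 : W`_3 != 0 by have /= -> := zx None.
  have : proj_zero W (Some r) by rewrite zx eqxx.
  have : proj_zero W (Some s) by rewrite zx eqxx orbT.
  rewrite /= !root_cubicp // => /eqP es /eqP er.
  (* The third root, from the sum of the roots; as a zero of [W] it has to be [r] or [s]. *)
  pose w := - (W`_2 / W`_3) - r - s.
  have w2 : W`_2 = - (W`_3 * (r + s + w)) by rewrite /w; field.
  have w1 : W`_1 = W`_3 * (r * s + r * w + s * w).
    apply/eqP; rewrite -subr_eq0; apply/eqP.
    apply: (@mulfI _ (r - s)); first by rewrite subr_eq0.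
    rewrite mulr0; transitivity ((W`_3 * r ^+ 3 + W`_2 * r ^+ 2 + W`_1 * r + W`_0)
      - (W`_3 * s ^+ 3 + W`_2 * s ^+ 2 + W`_1 * s + W`_0)).
      rewrite w2; ring.
    by rewrite er es subrr.
  have w0 : W`_0 = - (W`_3 * r * s * w).
    apply/eqP; rewrite -subr_eq0; apply/eqP; rewrite -[RHS]er w1 w2; ring.
  have : proj_zero W (Some w).
    by rewrite /= root_cubicp // w0 w1 w2; apply/eqP; ring.
  rewrite zx => /orP[] /eqP[] ew.
    apply: (two_point_form_finite w3 rs sW) => //; rewrite ?w0 ?w1 ?w2 ew; ring.
  rewrite eq_sym in rs.
  apply: (two_point_form_finite w3 rs sW) => //; rewrite ?w0 ?w1 ?w2 ew; ring.
- by apply: (inf r) => z; rewrite zx orbC.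
- exact: (inf s).
- by rewrite eqxx in xy.
Qed.

Lemma requiv_cubic_two_zeros f M W : transcendental f -> coprimep M W ->
  (size M <= 4)%N -> (size W <= 4)%N -> (M`_3 != 0) || (W`_3 != 0) -> W != 0 ->
  f = rpoly M / rpoly W -> #|[set x | proj_zero W x]%SET| = 2%N ->
  exists beta t, t != 0 /\ requiv f (cubic beta t).
Proof.
move=> tf cMW sM sW MW3 W0 fE /(two_point_form sW)[k [a [b [c [d [k0 dt eW]]]]]].
have formE p : exists n1 n2, cubic_formp (a *: 'X + b%:P) (c *: 'X + d%:P) p =
    cubicp (cubic_form a c p) n2 n1 (cubic_form b d p).
  by rewrite cubic_formp_linear; do 2 eexists.
have [Wac Wbd] : cubic_form a c W = 0 /\ cubic_form b d W = 0.
  have [w1 [w2]] := formE W; rewrite eW => eW'.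
  have [e3 _ _ e0] := coef_cubicp (cubic_form a c W) w2 w1 (cubic_form b d W).
  by move: e3 e0; rewrite -eW' !coefCM !coefX !mulr0 => <- <-.
have ac : (a != 0) || (c != 0).
  by apply: contraR dt; rewrite negb_or !negbK => /andP[/eqP-> /eqP->];
    rewrite mul0r mulr0 subrr.
have bd : (b != 0) || (d != 0).
  by apply: contraR dt; rewrite negb_or !negbK => /andP[/eqP-> /eqP->];
    rewrite mul0r mulr0 subrr.
(* The numerator vanishes at neither pole: at the double one this gives a leading coefficient in
   degree 3, at the simple one it gives [t != 0]. *)
have n3 := cubic_form_coprime sM sW cMW MW3 ac Wac.
have n0 := cubic_form_coprime sM sW cMW MW3 bd Wbd.
have [n1 [n2 eM]] := formE M.
pose N3 := cubic_form a c M; pose beta := n2 / N3; pose t := cubic_form b d M / N3.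
have n2E : n2 = N3 * beta by rewrite mulrC divfK.
have n0E : cubic_form b d M = N3 * t by rewrite mulrC divfK.
exists beta, t; split; first by rewrite mulf_neq0 ?invr_eq0.
have dt' : k * N3 - (- n1) * 0 != 0 by rewrite mulr0 subr0 mulf_neq0.
apply/requivP; split; first exact tf.
(* The denominator is now [k X], so [k v - n1] removes the term in [X] from the numerator, and
   division by [N3] makes it monic. *)
exists a, b, c, d, k, (- n1), 0, N3; split; [exact dt|exact dt'|].
have [den ->] := moebius_rcomp_cubic tf sM sW W0 fE dt dt'.
have X0 : 'X != 0 :> {poly F} by rewrite polyX_eq0.
apply/eqP; rewrite /cubic rpoly_div_eq // eM eW -/N3 n2E n0E /cubicp -!mul_polyC.
by apply/eqP; ring.
Qed.

Lemma class_II_cubic f : class_II f ->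
  exists beta t, t != 0 /\ requiv f (cubic beta t).
Proof.
move=> [df [alpha fib]].
have tf : transcendental f by apply: rdeg_transcendental; rewrite df.
have fE := rnum_rden f; have cND := coprime_rnum_rden f; have D0 := rden_neq0 f.
move: df fib; rewrite /rdeg /rfiber /reval.
move: (rnum f) (rden f) fE cND D0 => N D fE cND D0 df fib.
have size4 p : ((size p).-1 <= 3)%N -> (size p <= 4)%N by case: (size p).
have sN : (size N <= 4)%N by apply: size4; rewrite -df leq_maxl.
have sD : (size D <= 4)%N by apply: size4; rewrite -df leq_maxr.
have coef3 p : (size p <= 4)%N -> (p`_3 == 0) = (size p <= 3)%N.
  move=> sp; apply/eqP/idP => [p3|le]; last by rewrite nth_default.
  rewrite leqNgt; apply/negP => lt.
  have e : size p = 4%N by apply/anti_leq; rewrite sp lt.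
  by have := lead_coef_eq0 p; rewrite lead_coefE e p3 eqxx -size_poly_eq0 e.
have ND3 : (N`_3 != 0) || (D`_3 != 0).
  rewrite !coef3 // -negb_and; apply/andP => -[hN hD].
  have : (maxn (size N).-1 (size D).-1 <= 2)%N.
    by rewrite geq_max -!subn1 !leq_subLR hN hD.
  by rewrite df.
case: alpha fib => [a|] fib; last first.
  apply: (requiv_cubic_two_zeros tf cND sN sD ND3 D0 fE).
  rewrite -fib; apply: eq_card => -[x|]; rewrite !inE /=.
    by case: (root D x).
  case: ltnP => [lt|le]; rewrite coef3 // ?eqxx.
    exact: (leq_trans lt sN).
  apply/negbTE; move: ND3; rewrite !coef3 // -!ltnNge => /orP[lt|//].
  exact: (leq_trans lt le).
(* A finite value [a] is moved to infinity by [1 / (v - a)]: this turns [f] into [D / (N - a D)],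
   and the fiber into the zeros of the new denominator. *)
set W := N - a *: D.
have WE : W = (- a)%:P * D + N by rewrite /W polyCN mulNr mul_polyC addrC.
have sW : (size W <= 4)%N.
  rewrite (leq_trans (size_polyD _ _)) // geq_max sN size_polyN.
  by rewrite (leq_trans (size_scale_leq _ _)).
have cDW : coprimep D W by rewrite WE coprimep_addl_mul coprimep_sym.
have W3 : W`_3 = N`_3 - a * D`_3 by rewrite /W coefB coefZ.
have DW3 : (D`_3 != 0) || (W`_3 != 0).
  have [D3|//] := eqVneq D`_3 0.
  by move: ND3; rewrite W3 D3 mulr0 subr0 eqxx orbF.
have divE (x y : F) : y != 0 -> (Some (x / y) == Some a) = (x - a * y == 0).
  move=> y0; rewrite subr_eq0; apply/eqP/eqP => [[<-]|->]; first by rewrite divfK.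
  by rewrite mulfK.
have den u : u = f -> rconst 1 * u + rconst (- a) = rpoly W / rpoly D.
  move=> ->; rewrite fE rmorph1 mul1r rmorphN /W rmorphB -mul_polyC rmorphM.
  have d0 : rpoly D != 0 by rewrite rpoly_eq0.
  by rewrite mulrBl mulfK.
have dt : 1 * 1 - 0 * 0 != 0 :> F by rewrite mulr1 mulr0 subr0 oner_neq0.
have dt' : 0 * (- a) - 1 * 1 != 0 :> F by rewrite mul0r mulr1 sub0r oppr_eq0 oner_neq0.
have gE : moebius 0 1 1 (- a) f = rpoly D / rpoly W.
  by rewrite /moebius den // rmorph0 rmorph1 mul0r add0r mul1r invf_div.
have tg := moebius_transcendental tf dt'.
have W0 : W != 0.
  apply/eqP => W0; have := moebius_den_neq0 tf dt'.
  by rewrite den // W0 rmorph0 mul0r eqxx.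
have mob1 : moebius 1 0 0 1 ratX = ratX.
  by rewrite /moebius rmorph0 rmorph1 mul1r addr0 mul0r add0r divr1.
have rfg : requiv f (moebius 0 1 1 (- a) f).
  apply/requivP; split; first exact tf.
  exists 1, 0, 0, 1, 0, 1, 1, (- a); split; [exact dt|exact dt'|].
  by rewrite mob1 rcompXr.
have zW : #|[set x | proj_zero W x]%SET| = 2%N.
  rewrite -fib; apply: eq_card => -[x|]; rewrite !inE /=.
    have Wx : W.[x] = N.[x] - a * D.[x] by rewrite /W hornerD hornerN hornerZ.
    case: ifPn => Dx; last by rewrite divE // /root Wx.
    rewrite /root Wx (rootP Dx) mulr0 subr0; apply/negbTE.
    by apply: (coprimep_root _ Dx); rewrite coprimep_sym.
  rewrite W3; case: ltnP => [lt|le].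
    have D3 : D`_3 = 0 by apply/eqP; rewrite coef3 // -ltnS (leq_trans lt).
    by apply/negbTE; move: ND3; rewrite D3 mulr0 subr0 eqxx orbF.
  (* In this case [f] is finite at infinity, so [D] has full degree 3 and the index [(size D).-1] in
     [reval] equals 3. *)
  have D3 : D`_3 != 0.
    move: ND3; rewrite !coef3 // -!ltnNge => /orP[lt|//].
    exact: (leq_trans lt le).
  have sizeD : size D = 4%N.
    by apply/anti_leq; rewrite sD ltnNge -coef3.
  by rewrite lead_coefE sizeD /= divE.
have [beta [t [t0 rg]]] := requiv_cubic_two_zeros tg cDW sD sW DW3 W0 gE zW.
exists beta, t; split; [exact t0|exact (requiv_trans rfg rg)].
Qed.

End NormalForm.

(** * Cosets of the cubes, canonical representatives and the number of classes *)

Section Representatives.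
Variable F : finFieldType.
Implicit Types (f g : ratfun F) (C : {set {unit F}}).

Lemma uval_neq0 (t : {unit F}) : FinRing.uval t != 0.
Proof. by rewrite -unitfE (valP t). Qed.

Lemma unit_of (x : F) : x != 0 -> exists t : {unit F}, FinRing.uval t = x.
Proof. by rewrite -unitfE => ux; exists (FinRing.unit F ux). Qed.

Lemma unit_cubesP (x : {unit F}) :
  reflect (exists r : {unit F}, x = (r ^+ 3)%g) (x \in unit_cubes F).
Proof.
by apply: (iffP imsetP) => [[r _ ->]|[r ->]]; exists r.
Qed.

Section Transversal.
Variables (C : {set {unit F}}) (hC : cube_coset_reps C).

Lemma card_coset_rep (t : {unit F}) : #|C :&: (unit_cubes F :* t)%g| = 1%N.
Proof.
case/and3P: hC => _ _ /forall_inP h; apply/eqP; rewrite h //.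
by apply/rcosetsP; exists t; rewrite ?inE.
Qed.

Lemma cube_coset_rep (t : {unit F}) :
  exists2 c, c \in C & exists r : {unit F}, c = (t * r ^+ 3)%g.
Proof.
have /eqP/cards1P[c e] := card_coset_rep t.
have : c \in C :&: (unit_cubes F :* t)%g by rewrite e inE.
rewrite inE => /andP[cC /rcosetP[h /unit_cubesP[r ->] cE]].
by exists c => //; exists r; rewrite cE; apply: val_inj; rewrite /= mulrC.
Qed.

Lemma cube_coset_rep_inj (c c' r : {unit F}) : c \in C -> c' \in C ->
  c' = (c * r ^+ 3)%g -> c = c'.
Proof.
move=> cC c'C e; have /eqP/cards1P[x ex] := card_coset_rep c.
have : c \in C :&: (unit_cubes F :* c)%g.
  rewrite inE cC; apply/rcosetP; exists 1%g; last by rewrite mul1g.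
  by apply/unit_cubesP; exists 1%g; rewrite expg1n.
have : c' \in C :&: (unit_cubes F :* c)%g.
  rewrite inE c'C; apply/rcosetP; exists (r ^+ 3)%g; first by apply/unit_cubesP; exists r.
  by rewrite e; apply: val_inj; rewrite /= mulrC.
by rewrite ex !inE => /eqP -> /eqP ->.
Qed.

End Transversal.

Lemma unit_cubes_cycle : exists g : {unit F},
  #[g]%g = #|F|.-1 /\ unit_cubes F = <[g ^+ 3]>%g.
Proof.
have /cyclicP[g gE] := field_unit_group_cyclic [set: {unit F}]%G.
exists g; split; first by rewrite /order -gE card_finField_unit.
apply/setP => x; apply/unit_cubesP/cycleP => -[i ->].
  have : i \in <[g]>%g by rewrite -gE inE.
  by case/cycleP=> n ->; exists n; rewrite -!expgM mulnC.
by exists (g ^+ i)%g; rewrite -!expgM mulnC.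
Qed.

(** In a cyclic group of order [q - 1] the cubes have index [gcd(q - 1, 3)], which is 3 exactly when
    [q] is 1 modulo 3. *)
Lemma card_cube_coset_reps C : cube_coset_reps C ->
  #|C| = (if #|F| %% 3 == 1 then 3 else 1)%N.
Proof.
move=> /card_transversal ->.
have [g [og ->]] := unit_cubes_cycle.
have F1 : (1 < #|F|)%N := finNzRing_gt1 F.
have o0 : (0 < #|F|.-1)%N by rewrite -subn1 subn_gt0.
have -> : #|rcosets <[g ^+ 3]> [set: {unit F}]| = gcdn #|F|.-1 3.
  transitivity #|[set: {unit F}]%G : <[g ^+ 3]>%G|%g; first by [].
  rewrite -divgS ?finset.subsetT // -/(#[g ^+ 3]%g) orderXgcd og card_finField_unit.
  by rewrite divnA ?dvdn_gcdl // mulKn.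
have : (#|F| = #|F|.-1.+1)%N by rewrite prednK // ltnW.
move: #|F|.-1 => n ->.
rewrite gcdnC -gcdn_modr -[n.+1]addn1 -modnDml.
by case: (n %% 3)%N (ltn_pmod n (isT : 0 < 3)%N) => [|[|[|]]].
Qed.

Lemma canonical_IIP C g : canonical_II C g <->
  (exists2 t : {unit F}, t \in C & g = cubic 0 (FinRing.uval t)) \/
  (exists t : {unit F}, g = cubic 1 (FinRing.uval t)).
Proof.
have e0 (t : F) : cubicp 1 0 0 t = 'X^3 + t%:P by rewrite /cubicp; ring.
have e1 (t : F) : cubicp 1 1 0 t = 'X^3 + 'X^2 + t%:P by rewrite /cubicp; ring.
rewrite /canonical_II /cubic.
split=> -[[t tC ->]|[t ->]];
  first [by left; exists t; rewrite ?e0|by right; exists t; rewrite ?e1].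
Qed.

Lemma cubic_inj (beta t beta' t' : F) :
  cubic beta t = cubic beta' t' -> beta = beta' /\ t = t'.
Proof.
have X0 : 'X != 0 :> {poly F} by rewrite polyX_eq0.
move=> /eqP; rewrite /cubic rpoly_div_eq // => /eqP/(mulIf X0) e.
have [_ b _ c] := coef_cubicp 1 beta 0 t.
have [_ b' _ c'] := coef_cubicp 1 beta' 0 t'.
by move: b c; rewrite e b' c' => <- <-.
Qed.

Lemma canonical_class_II C g : canonical_II C g -> class_II g.
Proof.
by move/canonical_IIP => [[t _ ->]|[t ->]]; apply: cubic_class_II; exact: uval_neq0.
Qed.

Lemma class_II_transcendental f : class_II f -> transcendental f.
Proof. by move=> [df _]; apply: rdeg_transcendental; rewrite df. Qed.

Section Classification.
Variables (C : {set {unit F}}) (hC : cube_coset_reps C).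

Lemma class_II_canonical f : class_II f -> exists2 g, canonical_II C g & requiv f g.
Proof.
move/class_II_cubic => [beta [t [t0 rf]]].
have [b0|b0] := eqVneq beta 0.
  have [u uE] := unit_of t0; have [c cC [r cE]] := cube_coset_rep hC u.
  exists (cubic 0 (FinRing.uval c)).
    by apply/canonical_IIP; left; exists c.
  have := requiv_cubic_scale 0 t0 (uval_neq0 r).
  rewrite mul0r => s; move: rf; rewrite b0 => rf.
  have -> : FinRing.uval c = t * FinRing.uval r ^+ 3 by rewrite cE -uE.
  exact (requiv_trans rf s).
have bV : beta^-1 != 0 by rewrite invr_eq0.
have [u uE] := unit_of (mulf_neq0 t0 (expf_neq0 3 bV)).
exists (cubic 1 (FinRing.uval u)).
  by apply/canonical_IIP; right; exists u.
have s := requiv_cubic_scale beta t0 bV.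
rewrite divff // in s; rewrite uE; exact (requiv_trans rf s).
Qed.

Lemma canonical_requiv_eq g g' : canonical_II C g -> canonical_II C g' ->
  requiv g g' -> g = g'.
Proof.
move=> /canonical_IIP cg /canonical_IIP cg'.
have par (beta beta' : F) (t t' : {unit F}) :
    requiv (cubic beta (FinRing.uval t)) (cubic beta' (FinRing.uval t')) ->
    exists r : {unit F}, beta' = beta * FinRing.uval r /\ t' = (t * r ^+ 3)%g.
  move=> /(requiv_cubic_parameters (uval_neq0 t) (uval_neq0 t'))[r r0 [bE tE]].
  have [u uE] := unit_of r0; exists u; rewrite uE; split; first exact bE.
  by apply: val_inj; rewrite /= uE.
have n01 (r : F) : 1 = 0 * r -> False.
  by move/eqP; rewrite mul0r oner_eq0.
case: cg cg' => [[t tC ->]|[t ->]] [[t' t'C ->]|[t' ->]] /par[r [bE tE]].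
- by rewrite (cube_coset_rep_inj hC tC t'C tE).
- by case: (n01 _ bE).
- by move/eqP: bE; rewrite mul1r eq_sym (negbTE (uval_neq0 r)).
- have r1 : r = 1%g by apply: val_inj; rewrite /= -[LHS]mul1r -bE.
  by rewrite tE r1 expg1n mulg1.
Qed.

Lemma card_classes_II :
  (classes_II F #= `I_(if #|F| %% 3 == 1 then #|F| + 2 else #|F|)%N)%card.
Proof.
(* The parameters of the canonical functions: 3 or 1 coset representatives and [q - 1] units, in
   total [q + 2] or [q]. *)
pose T := ({c : {unit F} | c \in C} + {unit F})%type.
pose rep (x : T) : ratfun F := match x with
  | inl c => cubic 0 (FinRing.uval (val c)) | inr t => cubic 1 (FinRing.uval t) end.
have repC x : canonical_II C (rep x).
  apply/canonical_IIP; case: x => [c|t]; [left|right; by exists t].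
  by exists (val c); rewrite ?(valP c).
have F1 : (1 < #|F|)%N := finNzRing_gt1 F.
have cardT : #|{: T}| = (if #|F| %% 3 == 1 then #|F| + 2 else #|F|)%N.
  rewrite card_sum card_sig (eq_card (_ : _ =i C)); last by move=> x; rewrite inE.
  rewrite (card_cube_coset_reps hC) -cardsT card_finField_unit.
  by case: ifP => _; case: #|F| F1 => // n _; rewrite ?addn2 // addSn add0n.
pose cls (i : 'I_#|{: T}|) : set (ratfun F) :=
  [set g | requiv (rep (enum_val i)) g]%classic.
have rep_inj x y : requiv (rep x) (rep y) -> x = y.
  move/(canonical_requiv_eq (repC x) (repC y)).
  case: x y => [x|x] [y|y] /cubic_inj[].
  - by move=> _ /val_inj/val_inj ->.
  - by move/esym/eqP; rewrite oner_eq0.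
  - by move/eqP; rewrite oner_eq0.
  - by move=> _ /val_inj ->.
have tr x : transcendental (rep x).
  exact/class_II_transcendental/canonical_class_II/repC.
have clsE f g : requiv f g ->
    [set h | requiv f h]%classic = [set h | requiv g h]%classic.
  move=> fg; apply/seteqP; split => h /= r.
    exact (requiv_trans (requiv_sym fg) r).
  exact (requiv_trans fg r).
have cls_inj : injective cls.
  move=> i j e; apply: enum_val_inj; apply: rep_inj.
  have : cls j (rep (enum_val j)) by exact (requiv_refl (tr _)).
  by rewrite -e.
have -> : classes_II F = [set cls i | i in [set: 'I_#|{: T}|]]%classic.
  apply/seteqP; split => [_ [f cf <-]|_ [i _ <-]].
    have [g /canonical_IIP cg fg] := class_II_canonical cf.
    suff [x gE] : exists x, g = rep x.
      by exists (enum_rank x) => //; rewrite /cls enum_rankK -gE (clsE _ _ fg).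
    case: cg => [[t tC ->]|[t ->]].
      by exists (inl (exist _ t tC)).
    by exists (inr t).
  by exists (rep (enum_val i)) => //; exact: canonical_class_II.
rewrite -cardT.
apply: card_eq_trans (inj_card_eq _) _; first by move=> ? ? _ _; exact: cls_inj.
by rewrite card_eq_sym card_II.
Qed.

End Classification.
End Representatives.

Local Close Scope ring_scope.

Theorem theorem3p1 (q : nat) (F : finFieldType) (hq : #|F| = q)
    (C : {set {unit F}}) (hC : cube_coset_reps C) :
  [/\ (forall f : ratfun F, class_II f ->
         exists! g : ratfun F, canonical_II C g /\ requiv f g),
      (forall g : ratfun F, canonical_II C g -> class_II g) &
      (classes_II F #= `I_(if q %% 3 == 1 then q + 2 else q))%card].
Proof.
split; last by rewrite -hq; exact: card_classes_II hC.
  move=> f /(class_II_canonical hC)[g cg fg]; exists g; split=> // g' [cg' fg'].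
  apply: (canonical_requiv_eq hC cg cg').
  exact (requiv_trans (requiv_sym fg) fg').
exact: canonical_class_II.
Qed.
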